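(* Let $T\ge 1$ be an integer, $\alpha>0$, $\eta=\alpha/\sqrt{T}$, and $h(x)=\frac1\eta\ln(\cosh(\eta x))$. Then, against every adversary with $|g_t|\le1$ for all $t$, the Stein algorithm with input $h$ and parameters $\rho_t=\sqrt{T-t}$ ($t=0,\dots,T$) guarantees, for all $u\in[-1,1]$, $$\sum_{t=1}^Tg_t(x_t-u)\le\left[\frac{1}{2\alpha}\ln\big((1+u)^{1+u}(1-u)^{1-u}\big)+\mathbb{E}_{Z\sim\mathcal{N}(0,1)}\big[\alpha^{-1}\ln(\cosh(\alpha Z))\big]\right]\sqrt{T}+O(\log T),$$ with the convention $0^0=1$ when $u=\pm1$, where $O(\log T)$ denotes a term bounded by $C(1+\log T)$ for an absolute constant $C$.
   Context: Online linear optimization (OLO) game with horizon $T$: in each round $t=1,\dots,T$, the algorithm picks $x_t\in[-1,1]$ as a function of $g_1,\dots,g_{t-1}$ (and $T$); the adversary then picks $g_t\in\mathbb{R}$ as a function of $x_1,\dots,x_t$ (and $T$ and the algorithm); the algorithm observes $g_t$. Stein equation solution: for a $1$-Lipschitz $h:\mathbb{R}\to\mathbb{R}$, $\mu\in\mathbb{R}$, $\sigma>0$, let $f_{\mu,\sigma,h}:\mathbb{R}\to\mathbb{R}$ be the unique bounded solution of $\sigma^2f'(x)-(x-\mu)f(x)=h(x)-\mathbb{E}_{Z\sim\mathcal{N}(0,1)}[h(\mu+\sigma Z)]$ for all $x\in\mathbb{R}$. Stein algorithm with input $h$ and parameters $\rho_0\ge\rho_1\ge\dots\ge\rho_T\ge0$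 (with $\rho_t>0$ for $t<T$): set $s_0=0$; in round $t$ output $x_t=\mathbb{E}_{Z\sim\mathcal{N}(0,1)}[f_{s_{t-1},\rho_{t-1},h}(s_{t-1}+\rho_tZ)]$, observe $g_t$ and set $s_t=s_{t-1}+g_t$. *)

(* Defs.v *)
From HB Require Import structures.
From mathcomp Require Import all_boot all_order all_algebra.
From mathcomp Require Import all_classical all_reals all_analysis.

Set Implicit Arguments.
Unset Strict Implicit.
Unset Printing Implicit Defensive.

Import Order.TTheory GRing.Theory Num.Theory.
Import numFieldNormedType.Exports.

Local Open Scope classical_set_scope.
Local Open Scope ring_scope.

(* An algorithm maps [:: g_1; ..; g_(t-1)] to x_t; an adversary maps
   [:: x_1; ..; x_t] to g_t.  In both cases t is read off from the length of
   the argument. *)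
Definition olo_algorithm (R : realType) := seq R -> R.
Definition olo_adversary (R : realType) := seq R -> R.

(* ([:: x_1; ..; x_t], [:: g_1; ..; g_t]) *)
Fixpoint olo_history (R : realType) (alg : olo_algorithm R)
    (adv : olo_adversary R) (t : nat) : seq R * seq R :=
  if t is t'.+1 then
    let: (xs, gs) := olo_history alg adv t' in
    let xs' := rcons xs (alg gs) in
    (xs', rcons gs (adv xs'))
  else ([::], [::]).

(* Rounds are numbered from 1; the values at t = 0 are irrelevant. *)
Definition olo_x (R : realType) (alg : olo_algorithm R)
    (adv : olo_adversary R) (t : nat) : R :=
  last 0 (olo_history alg adv t).1.

Definition olo_g (R : realType) (alg : olo_algorithm R)
    (adv : olo_adversary R) (t : nat) : R :=
  last 0 (olo_history alg adv t).2.

Definition gauss_mean (R : realType) (phi : R -> R) : R :=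
  fine ('E_(@normal_prob R 0 1)[phi])%E.

Definition stein_solution (R : realType) (mu sigma : R) (h f : R -> R) : Prop :=
  bounded_fun f /\
  forall x : R, derivable f x 1 /\
    sigma ^+ 2 * 'D_1 f x - (x - mu) * f x
      = h x - gauss_mean (fun z => h (mu + sigma * z)).

(* The bounded solution exists and is unique when h is Lipschitz and
   sigma > 0; the default value 0 plays no role then. *)
Definition stein_f (R : realType) (mu sigma : R) (h : R -> R) : R -> R :=
  xget (fun=> 0) [set f | stein_solution mu sigma h f].

Definition stein_algorithm (R : realType) (h : R -> R) (rho : nat -> R) :
    olo_algorithm R :=
  fun gs =>
    let t := (size gs).+1 in
    let s := \sum_(g <- gs) g in
    gauss_mean (fun z => stein_f s (rho t.-1) h (s + rho t * z)).

Definition cosh (R : realType) (x : R) : R := (expR x + expR (- x)) / 2.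

(* Main.v *)
(* Write S_t = g_1 + ... + g_t and V_t = E[h(S_t + rho_t Z)].  At the point
   X = S_t + rho_t Z the Stein equation with mean S_(t-1) and variance
   rho_(t-1)^2 = rho_t^2 + 1, whose solution is f, expresses h(X) through f(X)
   and f'(X); after Gaussian integration by parts,
     V_t - V_(t-1) + g_t x_t = E[f'(X) - g_t (f(X) - f(X - g_t))].
   Since f' <= 0 (h is convex), |g_t| <= 1 and f' is Lipschitz with constant
   4 / rho_(t-1)^2, the right-hand side is at most 4 / (T - t + 1).  Summing
   leaves V_0 - h(S_T) - u S_T + O(log T), and Fenchel-Young for ln cosh
   concludes.

   The bounds on f, f' and f'' all come from a maximum principle for
   p' - x p = k: as (phi p)' = phi k with phi the Gaussian density, and phi p
   vanishes at infinity, a sign of k on one side of x0 forces p(x0) <= 0. *)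

Require Import Defs.
From HB Require Import structures.
From mathcomp Require Import all_boot all_order all_algebra.
From mathcomp Require Import all_classical all_reals all_analysis.
From mathcomp Require Import measurable_realfun ring lra.

Set Implicit Arguments.
Unset Strict Implicit.
Unset Printing Implicit Defensive.

Import Order.TTheory GRing.Theory Num.Theory.
Import numFieldNormedType.Exports.

Local Open Scope classical_set_scope.
Local Open Scope ring_scope.

(** * The standard Stein equation *)

Lemma continuous_of_derive (R : realType) (f df : R -> R) :
  (forall x : R, is_derive x 1 f (df x)) -> continuous f.
Proof.
move=> fdf x; apply: differentiable_continuous; apply/derivable1_diffP.
exact: (@ex_derive _ _ _ _ _ _ _ (fdf x)).
Qed.

Lemma mean_value (R : realType) (f df : R -> R) (a b : R) :
  (forall x : R, is_derive x 1 f (df x)) -> a <= b ->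
  exists2 c, a <= c <= b & f b - f a = df c * (b - a).
Proof.
move=> fdf ab.
have [] := @MVT_segment R f df a b ab (fun x _ => fdf x).
  exact/continuous_subspaceT/(continuous_of_derive fdf).
by move=> c; rewrite in_itv/= => cab e; exists c.
Qed.

(** * The standard Gaussian density and its decay *)

Section std_normal_pdf.
Variable R : realType.
Local Notation phi := (@normal_pdf R 0 1).

Lemma std_normal_pdfE x : phi x = normal_peak 1 * expR (- x ^+ 2 / 2).
Proof.
by rewrite normal_pdfE ?oner_eq0// /normal_fun subr0 expr1n.
Qed.

Lemma std_normal_pdf_gt0 x : 0 < phi x.
Proof. by rewrite std_normal_pdfE mulr_gt0 ?expR_gt0 ?normal_peak_gt0 ?oner_eq0. Qed.

Lemma is_derive_std_normal_pdf (x : R) : is_derive x 1 phi (- x * phi x).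
Proof.
have -> : phi = fun x => normal_peak 1 * expR (- x ^+ 2 / 2).
  by apply/funext => y; rewrite std_normal_pdfE.
apply: is_derive_eq.
by rewrite /GRing.scale/=; field.
Qed.

(** Quadratic decay, from 1 + t <= e^t at t = x^2 / 2; it is enough to beat linear growth. *)
Lemma std_normal_pdf_le (x : R) : phi x * (1 + x ^+ 2 / 2) <= normal_peak 1.
Proof.
rewrite std_normal_pdfE -mulrA ler_piMr ?normal_peak_ge0// mulNr expRN.
rewrite mulrC ler_pdivrMr ?expR_gt0// mul1r.
exact: expR_ge1Dx.
Qed.

End std_normal_pdf.

(** * Decay at infinity and the maximum principle *)

Section vanishing.
Variable R : realType.
Local Notation phi := (@normal_pdf R 0 1).

(* Integer points suffice for [stein_max_principle], where [phi p] is monotone on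
   the ray considered. *)
Definition vanishing (q : R -> R) :=
  (q n%:R @[n --> \oo] --> (0 : R)) /\ (q (- n%:R) @[n --> \oo] --> (0 : R)).

Lemma vanishingB (p q : R -> R) :
  vanishing p -> vanishing q -> vanishing (fun x => p x - q x).
Proof.
by move=> [p1 p2] [q1 q2]; split; rewrite -(subrr (0 : R)); exact: cvgB.
Qed.

Lemma vanishingN (p : R -> R) : vanishing p -> vanishing (fun x => - p x).
Proof. by move=> [p1 p2]; split; rewrite -(oppr0 R); exact: cvgN. Qed.

Lemma harmonic_dominated_cvg0 (u : nat -> R) (C : R) :
  (forall n, `|u n| <= C * harmonic n) -> u n @[n --> \oo] --> (0 : R).
Proof.
move=> uC; apply: norm_cvg0.
apply: (@squeeze_cvgr _ _ _ _ (fun=> 0) (fun n => C * harmonic n)).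
- by apply: nearW => n; rewrite normr_ge0 uC.
- exact: cvg_cst.
- rewrite -(mulr0 C); apply: cvgM; [exact: cvg_cst|exact: cvg_harmonic].
Qed.

Lemma vanishing_linear_growth (p : R -> R) (A : R) :
  (forall x, `|p x| <= A * (1 + `|x|)) -> vanishing (fun x => phi x * p x).
Proof.
move=> pA.
have A0 : 0 <= A by have := pA 0; rewrite normr0 addr0 mulr1; exact: le_trans.
have key (x : R) n : `|x| = n%:R ->
    `|phi x * p x| <= 4 * normal_peak 1 * A * harmonic n.
  move=> xn; rewrite normrM (gtr0_norm (std_normal_pdf_gt0 x)) /harmonic/=.
  have n0 : 0 < n.+1%:R :> R by rewrite ltr0n.
  rewrite ler_pdivlMr//.
  apply: (@le_trans _ _ (phi x * (A * n.+1%:R) * n.+1%:R)).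
    apply: ler_wpM2r; first exact: ltW.
    apply: ler_wpM2l; first exact/ltW/std_normal_pdf_gt0.
    by rewrite (le_trans (pA x))// xn -natr1 addrC.
  have -> : phi x * (A * n.+1%:R) * n.+1%:R = phi x * n.+1%:R ^+ 2 * A by ring.
  apply: ler_wpM2r => //.
  (* The factor 4 comes from (n + 1)^2 <= 4 (1 + n^2 / 2), whose difference is (n - 1)^2 + 2. *)
  apply: (@le_trans _ _ (phi x * (4 * (1 + x ^+ 2 / 2)))).
    apply: ler_wpM2l; first exact/ltW/std_normal_pdf_gt0.
    rewrite -[x ^+ 2](@real_normK _ x) ?num_real// xn -natr1.
    have := sqr_ge0 (n%:R - 1 : R); nra.
  rewrite mulrCA; apply: ler_wpM2l => //; exact: std_normal_pdf_le.
split.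
  apply: harmonic_dominated_cvg0 => n; apply: key.
  by rewrite ger0_norm// ler0n.
apply: harmonic_dominated_cvg0 => n; apply: key.
by rewrite normrN ger0_norm// ler0n.
Qed.

Lemma vanishing_cst (K : R) : vanishing (fun x => phi x * K).
Proof.
apply: (@vanishing_linear_growth (fun=> K) `|K|) => x.
by rewrite ler_peMr// lerDl.
Qed.

(** In the first case [phi p] is nondecreasing to the right of [x0], in the second nonincreasing to
    its left. Either way its value at [x0] is at most its limit 0 along that ray. *)
Lemma stein_max_principle (p k : R -> R) (x0 : R) :
  (forall x : R, is_derive x 1 p (x * p x + k x)) ->
  vanishing (fun x => phi x * p x) ->
  (forall x, x0 <= x -> 0 <= k x) \/ (forall x, x <= x0 -> k x <= 0) ->
  p x0 <= 0.
Proof.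
move=> dp [vp vN] ksgn.
have dq (x : R) : is_derive x 1 (fun x => phi x * p x) (phi x * k x).
  have dphi := is_derive_std_normal_pdf x.
  have dpx := dp x.
  apply: is_derive_eq; rewrite /GRing.scale/=; ring.
suff : phi x0 * p x0 <= 0 by rewrite pmulr_rle0 ?std_normal_pdf_gt0.
case: ksgn => ksgn.
- rewrite -[leRHS](cvg_lim _ vp)//; apply: limr_ge; first by apply/cvg_ex; exists 0.
  near=> n.
  have x0n : x0 <= n%:R by near: n; exact: nbhs_infty_ger.
  have [c /andP[xc _] e] := mean_value dq x0n.
  rewrite -subr_ge0 e mulr_ge0// ?subr_ge0// mulr_ge0// ?ksgn//.
  exact/ltW/std_normal_pdf_gt0.
- rewrite -[leRHS](cvg_lim _ vN)//; apply: limr_ge; first by apply/cvg_ex; exists 0.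
  near=> n.
  have x0n : - n%:R <= x0.
    by rewrite lerNl; near: n; exact: nbhs_infty_ger.
  have [c /andP[_ xc] e] := mean_value dq x0n.
  rewrite -subr_le0 /= e mulr_le0_ge0// ?subr_ge0//.
  rewrite mulr_ge0_le0// ?ksgn//.
  exact/ltW/std_normal_pdf_gt0.
Unshelve. all: by end_near. Qed.

(** The sign of [k x0] decides which ray to use. *)
Lemma stein_max_principle_ndecr (p k : R -> R) (x0 : R) :
  (forall x : R, is_derive x 1 p (x * p x + k x)) ->
  vanishing (fun x => phi x * p x) ->
  {homo k : x y / x <= y} -> p x0 <= 0.
Proof.
move=> dp vp kincr; apply: (stein_max_principle dp vp).
have [k0|/ltW k0] := leP 0 (k x0); [left|right] => x /kincr.
  exact: le_trans.
by move=> /le_trans; exact.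
Qed.

End vanishing.

(** * Bounds on a solution of the standard equation and on its first two derivatives *)

Section standard_stein_equation.
Variables (R : realType) (H H' f : R -> R) (c sigma : R).
Local Notation phi := (@normal_pdf R 0 1).
Hypothesis dH : forall x : R, is_derive x 1 H (H' x).
Hypothesis H'_le : forall x, `|H' x| <= sigma.
Hypothesis df : forall x : R, is_derive x 1 f (x * f x + (H x - c)).
Hypothesis vf : vanishing (fun x => phi x * f x).

Let sigma_ge0 : 0 <= sigma.
Proof. exact: le_trans (normr_ge0 (H' 0)) (H'_le 0). Qed.

Lemma lipschitz_of_derive x y : x <= y -> `|H y - H x| <= sigma * (y - x).
Proof.
move=> xy; have [z _ ->] := mean_value dH xy.
by rewrite normrM (@ger0_norm _ (y - x)) ?subr_ge0// ler_wpM2r ?subr_ge0.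
Qed.

Lemma linear_growth_of_derive x : `|H x| <= (`|H 0| + sigma) * (1 + `|x|).
Proof.
have : `|H x - H 0| <= sigma * `|x|.
  have [x0|/ltW x0] := leP 0 x.
    by have := lipschitz_of_derive x0; rewrite subr0 (ger0_norm x0).
  by have := lipschitz_of_derive x0; rewrite sub0r (ler0_norm x0) distrC.
have := ler_normD (H x - H 0) (H 0); rewrite subrK.
have := normr_ge0 x; have := normr_ge0 (H 0); have := sigma_ge0; nra.
Qed.

Let vanishing_cst_sub (K : R) : vanishing (fun x => phi x * (f x - K)).
Proof.
by have := vanishingB vf (vanishing_cst K); congr vanishing; apply/funext => x; ring.
Qed.

(** Comparison with the constants sigma and -sigma: subtracting a constant adds a term sigma x to
    the forcing, which the Lipschitz bound on [H] makes nondecreasing. *)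
Lemma standard_stein_bound x : `|f x| <= sigma.
Proof.
have lip := lipschitz_of_derive.
rewrite ler_norml; apply/andP; split.
- rewrite lerNl -subr_le0.
  apply: (@stein_max_principle_ndecr _ (fun x => - f x - sigma)
    (fun x => sigma * x - (H x - c))).
  + move=> y; have dfy := df y; apply: is_derive_eq.
    rewrite /GRing.scale/=; ring.
  + have := vanishingN (vanishing_cst_sub (- sigma)).
    by congr vanishing; apply/funext => y; ring.
  + move=> y z yz; have := lip _ _ yz; rewrite ler_norml => /andP[_]; lra.
- rewrite -subr_le0.
  apply: (@stein_max_principle_ndecr _ (fun x => f x - sigma)
    (fun x => sigma * x + (H x - c))).
  + move=> y; have dfy := df y; apply: is_derive_eq.
    rewrite /GRing.scale/=; ring.
  + exact: vanishing_cst_sub.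
  + move=> y z yz; have := lip _ _ yz; rewrite ler_norml => /andP[+ _]; lra.
Qed.

(** This is f', read off the equation. *)
Let p x := x * f x + (H x - c).

Lemma stein_derivative_growth x :
  `|p x| <= (`|H 0| + `|c| + 2 * sigma) * (1 + `|x|).
Proof.
have := ler_normD (x * f x) (H x - c); have := ler_normB (H x) c.
have := linear_growth_of_derive x; have := standard_stein_bound x.
rewrite -/(p x) normrM.
have := normr_ge0 x; have := normr_ge0 (H 0); have := normr_ge0 c.
have := sigma_ge0; have := normr_ge0 (f x); nra.
Qed.

Lemma vanishing_stein_derivative : vanishing (fun x => phi x * p x).
Proof. exact: vanishing_linear_growth stein_derivative_growth. Qed.

(** Differentiating the equation gives p' = x p + w, so the maximum principle applies to [p] as
    well, with forcing [w]. *)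
Let w x := f x + H' x.

Lemma is_derive_stein_derivative (x : R) : is_derive x 1 p (x * p x + w x).
Proof.
rewrite /p; have dfx := df x; have dHx := dH x; apply: is_derive_eq.
rewrite /GRing.scale/= /w; ring.
Qed.

Variable H'' : R -> R.
Hypothesis dH' : forall x : R, is_derive x 1 H' (H'' x).
Hypothesis H''_ge0 : forall x, 0 <= H'' x.

Let is_derive_w (x : R) : is_derive x 1 w (p x + H'' x).
Proof.
rewrite /w; have dfx := df x; have dHx := dH' x; apply: is_derive_eq.
by rewrite /p.
Qed.

Let dq (x : R) : is_derive x 1 (fun x => phi x * p x) (phi x * w x).
Proof.
have dphi := is_derive_std_normal_pdf x.
have dpx := is_derive_stein_derivative x.
apply: is_derive_eq; rewrite /GRing.scale/=; ring.
Qed.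

(* At a positive interior maximum [m] of [phi p] one would have [w m = 0] and
   [w' m >= p m > 0], so that [phi p] would increase to the right of [m]. *)
Lemma stein_derivative_le0 x : p x <= 0.
Proof.
rewrite leNgt; apply/negP => px0.
have phi_gt0 := @std_normal_pdf_gt0 R.
pose q x := phi x * p x.
have qx0 : 0 < q x by exact: mulr_gt0.
have [vp vN] := vanishing_stein_derivative.
(* Both endpoint values lie below [q x], which forces the maximum on [-n, n] into the interior. *)
have [n [xn qn qNn]] : exists n : nat, [/\ `|x| < n%:R, q n%:R < q x & q (- n%:R) < q x].
  near \oo => n; exists n; split.
  - near: n; exact: nbhs_infty_gtr.
  - by near: n; exact: (cvgr_lt _ vp).
  - by near: n; exact: (cvgr_lt _ vN).
have /andP[nx xn'] : - n%:R < x < n%:R by rewrite -ltr_norml.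
have nn : - n%:R <= n%:R :> R by rewrite (le_trans (ltW nx))// ltW.
have cq : {within `[- n%:R, n%:R], continuous q}.
  exact/continuous_subspaceT/(continuous_of_derive dq).
have [m + qm] := EVT_max nn cq.
rewrite in_itv/= => /andP[nm mn].
have qxm : q x <= q m by apply: qm; rewrite in_itv/= !ltW.
have {}nm : - n%:R < m.
  rewrite lt_neqAle nm andbT; apply: contraTneq qxm => <-; by rewrite -ltNge.
have {}mn : m < n%:R.
  rewrite lt_neqAle mn andbT; apply: contraTneq qxm => ->; by rewrite -ltNge.
have dm0 : is_derive m 1 q 0.
  apply: (derive1_at_max nn) => [t _||t].
  - exact: (@ex_derive _ _ _ _ _ _ _ (dq t)).
  - by rewrite in_itv/= nm mn.
  - rewrite in_itv/= => /andP[nt tn]; apply: qm; rewrite in_itv/= !ltW//.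
have wm0 : w m = 0.
  have dqm := @derive_val _ _ _ _ _ _ _ (dq m).
  have /eqP := etrans (esym dqm) (@derive_val _ _ _ _ _ _ _ dm0).
  by rewrite mulf_eq0 gt_eqF//= => /eqP.
have pm0 : 0 < p m by rewrite -(pmulr_rgt0 _ (phi_gt0 m)) (lt_le_trans qx0).
have cp : {for m, continuous p}.
  exact: (continuous_of_derive is_derive_stein_derivative).
have [e e0 pe] : exists2 e : R, 0 < e & forall y, `|y - m| < e -> 0 < p y.
  have /cvgr_gt/(_ _ pm0)/nbhs_ballP[e e0 be] := cp.
  by exists e => // y ye; apply: be; rewrite /ball/= distrC.
(* Short enough that [p] stays positive on [m, m + d] and that m + d remains in [-n, n]. *)
pose d := Num.min (e / 2) (n%:R - m).
have d0 : 0 < d by rewrite lt_min divr_gt0//= subr_gt0.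
have de : d < e by rewrite gt_min; apply/orP; left; lra.
have dn : m + d <= n%:R by rewrite addrC -lerBrDr ge_min lexx orbT.
have wpos y : m < y -> y <= m + d -> 0 < w y.
  move=> my yd; have [z /andP[mz zy]] := mean_value is_derive_w (ltW my).
  rewrite wm0 subr0 => ->; rewrite mulr_gt0 ?subr_gt0//.
  rewrite ltr_wpDr//; apply: pe; rewrite ger0_norm ?subr_ge0//.
  lra.
have cq' : {within `[m, m + d], continuous q}.
  exact/continuous_subspaceT/(continuous_of_derive dq).
have md : m < m + d by lra.
have [z + qmd] := MVT md (fun x _ => dq x) cq'.
rewrite in_itv/= => /andP[mz zd].
have : 0 < q (m + d) - q m.
  by rewrite qmd mulr_gt0//; [rewrite mulr_gt0// wpos// ltW|lra].
rewrite subr_gt0 ltNge => /negP; apply; apply: qm; rewrite in_itv/=; lra.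
Unshelve. all: by end_near. Qed.

Let w_bound x : `|w x| <= 2 * sigma.
Proof.
by have := ler_normD (f x) (H' x); have := standard_stein_bound x; have := H'_le x; lra.
Qed.

(** As p <= 0, only -p needs an upper bound. It is compared with the constant K = 2 sigma / |x|: the
    forcing y K - w(y) has the sign of x for y beyond x, since there |y| K >= 2 sigma >= |w(y)|. *)
Lemma stein_derivative_mul_bound x : `|x * p x| <= 2 * sigma.
Proof.
have px := stein_derivative_le0 x.
have [->|x0] := eqVneq x 0; first by rewrite mul0r normr0 mulr_ge0.
have nx0 : 0 < `|x| by rewrite normr_gt0.
pose K := 2 * sigma / `|x|.
suff : - p x - K <= 0.
  by rewrite normrM (ler0_norm px) subr_le0 ler_pdivlMr// mulrC.
apply: (@stein_max_principle _ (fun y => - p y - K) (fun y => y * K - w y)).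
- move=> y; have dpy := is_derive_stein_derivative y; apply: is_derive_eq.
  rewrite /GRing.scale/=; ring.
- have := vanishingB (vanishingN vanishing_stein_derivative) (vanishing_cst K).
  by congr vanishing; apply/funext => y; ring.
- move: x0; rewrite neq_lt => /orP[x0|x0]; [right|left] => y yx.
  + rewrite subr_le0 (@le_trans _ _ (- (2 * sigma)))//; last first.
      by have := w_bound y; rewrite ler_norml => /andP[].
    rewrite /K (ltr0_norm x0) mulrA ler_pdivrMr ?oppr_gt0// mulrNN.
    by rewrite mulrC ler_wpM2l// mulr_ge0.
  + rewrite subr_ge0 (@le_trans _ _ (2 * sigma))//.
      by have := w_bound y; rewrite ler_norml => /andP[].
    by rewrite /K (gtr0_norm x0) mulrA ler_pdivlMr// mulrC ler_wpM2r// mulr_ge0.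
Qed.

(** The derivative of [p] is z p + w, and each term is at most 2 sigma in absolute value. *)
Lemma stein_derivative_lipschitz x y :
  x <= y -> `|p y - p x| <= 4 * sigma * (y - x).
Proof.
move=> xy; have [z _ ->] := mean_value is_derive_stein_derivative xy.
rewrite normrM (@ger0_norm _ (y - x)) ?subr_ge0// ler_wpM2r ?subr_ge0//.
have := ler_normD (z * p z) (w z).
by have := stein_derivative_mul_bound z; have := w_bound z; lra.
Qed.

End standard_stein_equation.

(** * Gaussian expectations *)

Section gaussian_integral.
Variable R : realType.
Local Notation mu := (@lebesgue_measure R).
Local Notation phi := (@normal_pdf R 0 1).
Local Notation P := (@normal_prob R 0 1).

(** Dominated convergence for the restrictions of [g], with dominating function |g|; at each point
    the restrictions are eventually constant. *)
Lemma cvg_Rintegral_set (g : R -> R) (D_ : nat -> set R) (D : set R) :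
  mu.-integrable setT (EFin \o g) ->
  (forall n, measurable (D_ n)) -> measurable D ->
  (forall x, \forall n \near \oo, (x \in D_ n) = (x \in D)) ->
  \int[mu]_(x in D_ n) g x @[n --> \oo] --> \int[mu]_(x in D) g x.
Proof.
move=> gint mD_ mD DnD.
pose G := EFin \o g.
have iD B : measurable B -> mu.-integrable B G.
  by move=> mB; apply: integrableS gint.
have iG := iD _ measurableT.
have /measurable_EFinP mg := measurable_int mu iG.
have : (\int[mu]_(x in D_ n) G x)%E @[n --> \oo] --> (\int[mu]_(x in D) G x)%E.
  have restr B : (\int[mu]_(x in B) G x = \int[mu]_x (G \_ B) x)%E.
    exact: integral_mkcond.
  rewrite restr; under eq_fun do rewrite restr.
  apply: (@dominated_cvg _ _ R mu setT measurableT _ _ (fun x => `|G x|%E)).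
  - move=> n; rewrite restrict_EFin; apply/measurable_EFinP.
    apply: (measurable_restrictT g (mD_ n)).1; exact: measurable_funTS.
  - move=> x _; apply: cvg_near_cst.
    by apply: filterS (DnD x) => n e; rewrite /patch e.
  - by move=> x _.
  - exact: integrable_abse.
  - by move=> n x _; rewrite /patch; case: ifP => // _; rewrite abse0 abse_ge0.
rewrite -[X in _ --> X]fineK; first exact: fine_cvg.
exact/integrable_fin_num/iD.
Qed.

(** The fundamental theorem of calculus on [-n, n], whose boundary terms tend to 0. *)
Lemma Rintegral_derivative (Q g : R -> R) :
  (forall x : R, is_derive x 1 Q (g x)) -> continuous g ->
  mu.-integrable setT (EFin \o g) -> vanishing Q -> \int[mu]_x g x = 0.
Proof.
move=> dQ cg ig [vQ vQN].
have h : \int[mu]_(x in `[- n%:R, n%:R]) g x @[n --> \oo] --> \int[mu]_x g x.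
  apply: cvg_Rintegral_set => // x; near=> n.
  rewrite in_setT; apply/mem_set; rewrite /= in_itv/= -ler_norml.
  near: n; exact: nbhs_infty_ger.
have h0 : \int[mu]_(x in `[- n%:R, n%:R]) g x @[n --> \oo] --> (0 : R).
  rewrite -[X in _ --> X](subr0 0).
  apply: cvg_trans (cvgB vQ vQN); apply: near_eq_cvg.
  near=> n.
  have n0 : (0 < n)%N by near: n; exact: nbhs_infty_gt.
  rewrite /Rintegral (@continuous_FTC2 _ g Q)//.
  - by rewrite (lt_trans (_ : _ < 0))// ?oppr_lt0 ltr0n.
  - exact: continuous_subspaceT.
  - have cQ := continuous_of_derive dQ.
    split.
    + by move=> x _; exact: (@ex_derive _ _ _ _ _ _ _ (dQ x)).
    + exact/cvg_at_right_filter/cQ.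
    + exact/cvg_at_left_filter/cQ.
  - by move=> x _; rewrite derive1E (@derive_val _ _ _ _ _ _ _ (dQ x)).
by rewrite -(cvg_lim _ h)// (cvg_lim _ h0).
Unshelve. all: by end_near. Qed.

(** The dominating function is a multiple of the Gaussian density of variance 2: of e^(-x^2/2) =
    (e^(-x^2/4))^2, one factor absorbs the growth through 1 + |x| <= 2 (1 + x^2/4) <= 2
    e^(x^2/4). *)
Lemma integrable_linear_growth (q : R -> R) (A : R) :
  continuous q -> (forall x, `|q x| <= A * (1 + `|x|)) ->
  mu.-integrable setT (EFin \o (fun x => phi x * q x)).
Proof.
move=> cq qA.
have A0 : 0 <= A by have := qA 0; rewrite normr0 addr0 mulr1; exact: le_trans.
pose s : R := Num.sqrt 2.
have s0 : s != 0 by rewrite gt_eqF// sqrtr_gt0.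
pose K := 2 * A * normal_peak 1 / normal_peak s.
have mphi : measurable_fun setT phi by exact: measurable_normal_pdf.
apply: (@le_integrable _ _ _ mu setT measurableT _
  (fun x => (K * normal_pdf 0 s x)%:E)).
- apply/measurable_EFinP/measurable_funM => //.
  exact: continuous_measurable_fun.
- move=> x _ /=; rewrite lee_fin normrM (gtr0_norm (std_normal_pdf_gt0 x)).
  rewrite [leRHS]ger0_norm; last first.
    by rewrite mulr_ge0 ?normal_pdf_ge0// !mulr_ge0 ?invr_ge0 ?normal_peak_ge0.
  rewrite std_normal_pdfE normal_pdfE// /normal_fun subr0 sqr_sqrtr//.
  have -> : K * (normal_peak s * expR (- x ^+ 2 / (2 *+ 2))) =
      normal_peak 1 * (2 * A * expR (- x ^+ 2 / (2 *+ 2))).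
    by rewrite /K; field; rewrite gt_eqF// normal_peak_gt0.
  rewrite -[leLHS]mulrA ler_wpM2l ?normal_peak_ge0//.
  have -> : expR (- x ^+ 2 / 2) =
      expR (- x ^+ 2 / (2 *+ 2)) * expR (- (x ^+ 2 / (2 *+ 2))).
    by rewrite -expRD; congr expR; field.
  rewrite [leRHS]mulrC -mulrA ler_wpM2l ?expR_ge0//.
  rewrite expRN mulrC ler_pdivrMr ?expR_gt0//.
  apply: (le_trans (qA x)); rewrite [2 * A]mulrC -mulrA ler_wpM2l//.
  have := expR_ge1Dx (x ^+ 2 / (2 *+ 2)).
  rewrite -[x ^+ 2](@real_normK _ x) ?num_real//.
  have := sqr_ge0 (`|x| - 1); nra.
- rewrite (_ : (fun x => _) = (fun x => K%:E * (normal_pdf 0 s x)%:E))%E//.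
  apply: integrableZl => //; exact: integrable_normal_pdf.
Qed.

(** The Radon-Nikodym derivative of [P] equals [phi] almost everywhere, as both have the same
    integral over every measurable set. The nonnegative case presupposes no integrability, so it can
    serve to prove integrability under [P]. *)
Lemma ge0_integral_std_normal_prob (f : R -> \bar R) :
  measurable_fun setT f -> (forall x, 0 <= f x)%E ->
  (\int[P]_x f x = \int[mu]_x (f x * (phi x)%:E))%E.
Proof.
move=> mf f0.
have numu := @normal_prob_dominates R 0 1.
rewrite -(Radon_Nikodym_SigmaFinite.change_of_variables numu)//.
apply: ae_eq_integral => //.
- apply: emeasurable_funM => //.
  exact: measurable_int (Radon_Nikodym_SigmaFinite.f_integrable _).
- apply: emeasurable_funM => //; apply/measurable_EFinP. exact: measurable_normal_pdf.
- apply: ae_eqe_mul2l => /=.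
  apply: integral_ae_eq => //=.
  + exact: Radon_Nikodym_SigmaFinite.f_integrable.
  + by apply/measurable_EFinP; exact: measurable_normal_pdf.
  + by move=> E _ mE; rewrite -Radon_Nikodym_SigmaFinite.f_integral.
Qed.

Lemma integrable_std_normal_prob (q : R -> R) (A : R) :
  continuous q -> (forall x, `|q x| <= A * (1 + `|x|)) ->
  P.-integrable setT (EFin \o q).
Proof.
move=> cq qA.
have mq : measurable_fun setT q by exact: continuous_measurable_fun.
apply/integrableP; split; first exact/measurable_EFinP.
rewrite ge0_integral_std_normal_prob//=; last first.
  apply/measurable_EFinP; exact: measurableT_comp.
have /integrableP[_] := integrable_linear_growth cq qA.
under eq_integral do rewrite /= normrM (gtr0_norm (std_normal_pdf_gt0 _)) mulrC EFinM.
by [].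
Qed.

Lemma gauss_mean_lebesgue (q : R -> R) (A : R) :
  continuous q -> (forall x, `|q x| <= A * (1 + `|x|)) ->
  gauss_mean q = \int[mu]_x (phi x * q x).
Proof.
move=> cq qA.
have iq := integrable_std_normal_prob cq qA.
rewrite /gauss_mean unlock /Rintegral; congr fine.
under [RHS]eq_integral do rewrite mulrC EFinM.
have numu := @normal_prob_dominates R 0 1.
rewrite -(Radon_Nikodym_change_of_variables numu)//.
have mq : measurable_fun setT (EFin \o q) by exact: measurable_int iq.
apply: ae_eq_integral => //.
- by apply: emeasurable_funM.
- apply: emeasurable_funM => //; apply/measurable_EFinP.
  exact: measurable_normal_pdf.
- apply: ae_eqe_mul2l => /=.
  apply: integral_ae_eq => //=.
  + exact: Radon_Nikodym_integrable.
  + by apply/measurable_EFinP; exact: measurable_normal_pdf.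
  + by move=> E _ mE; rewrite -Radon_Nikodym_integral.
Qed.

(** A class of integrands stable under sums, scaling and affine substitution, on which the Gaussian
    expectation is finite, so that [fine] in [gauss_mean] loses nothing. *)
Definition continuous_linear_growth (q : R -> R) :=
  continuous q /\ exists A, forall x, `|q x| <= A * (1 + `|x|).
Local Notation clg := continuous_linear_growth.

Lemma linear_growthD (p q : R -> R) : clg p -> clg q -> clg (fun x => p x + q x).
Proof.
move=> [cp [A pA]] [cq [B qB]]; split.
  by move=> x; apply: cvgD; [exact: cp|exact: cq].
exists (A + B) => x; rewrite mulrDl (le_trans (ler_normD _ _))//.
by rewrite lerD.
Qed.

Lemma linear_growthZ (k : R) (q : R -> R) : clg q -> clg (fun x => k * q x).
Proof.
move=> [cq [B qB]]; split.
  by move=> x; apply: cvgM; [exact: cvg_cst|exact: cq].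
by exists (`|k| * B) => x; rewrite normrM -mulrA ler_wpM2l.
Qed.

Lemma linear_growth_cst (k : R) : clg (fun=> k).
Proof.
split; first by move=> x; exact: cvg_cst.
by exists `|k| => x; rewrite ler_peMr// lerDl.
Qed.

Lemma linear_growth_mul_bounded (q : R -> R) (K : R) :
  continuous q -> (forall x, `|q x| <= K) -> clg (fun x => x * q x).
Proof.
move=> cq qK; split.
  by move=> x; apply: cvgM; [exact: cvg_id|exact: cq].
exists K => x; rewrite normrM.
have K0 : 0 <= K by exact: le_trans (qK 0).
have := qK x; have := normr_ge0 x; have := normr_ge0 (q x); nra.
Qed.

Lemma linear_growth_comp_affine (q : R -> R) (m s : R) :
  clg q -> clg (fun x => q (m + s * x)).
Proof.
move=> [cq [A qA]]; split.
  move=> x; apply: (@continuous_comp _ _ _ (fun x => m + s * x) q); last exact: cq.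
  apply: cvgD; first exact: cvg_cst.
  by apply: cvgM; [exact: cvg_cst|exact: cvg_id].
have A0 : 0 <= A by have := qA 0; rewrite normr0 addr0 mulr1; exact: le_trans.
exists (A * (1 + `|m| + `|s|)) => x; apply: (le_trans (qA _)).
rewrite -mulrA ler_wpM2l//.
have := ler_normD m (s * x); rewrite normrM.
have := normr_ge0 m; have := normr_ge0 s; have := normr_ge0 x; nra.
Qed.

Lemma gauss_meanD (p q : R -> R) : clg p -> clg q ->
  gauss_mean (fun x => p x + q x) = gauss_mean p + gauss_mean q.
Proof.
move=> [cp [A pA]] [cq [B qB]]; rewrite /gauss_mean unlock.
by rewrite -[LHS]/(Rintegral _ _ _) RintegralD//;
  [exact: integrable_std_normal_prob pA|exact: integrable_std_normal_prob qB].
Qed.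

Lemma gauss_meanZ (k : R) (q : R -> R) : clg q ->
  gauss_mean (fun x => k * q x) = k * gauss_mean q.
Proof.
move=> [cq [B qB]]; rewrite /gauss_mean unlock.
by rewrite -[LHS]/(Rintegral _ _ _) RintegralZl//; exact: integrable_std_normal_prob qB.
Qed.

Lemma gauss_mean_cst (k : R) : gauss_mean (fun=> k) = k.
Proof. by rewrite /gauss_mean (@expectation_cst _ _ _ P k). Qed.

Lemma gauss_meanN (q : R -> R) : clg q ->
  gauss_mean (fun x => - q x) = - gauss_mean q.
Proof.
move=> qg; rewrite -mulN1r -gauss_meanZ//.
by congr gauss_mean; apply/funext => x; rewrite mulN1r.
Qed.

Lemma gauss_mean_le (p q : R -> R) : clg p -> clg q ->
  (forall x, p x <= q x) -> gauss_mean p <= gauss_mean q.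
Proof.
move=> [cp [A pA]] [cq [B qB]] pq; rewrite /gauss_mean unlock.
apply: le_Rintegral => //;
  [exact: integrable_std_normal_prob pA|exact: integrable_std_normal_prob qB].
Qed.

(** The derivative of [phi q] is phi (q' - x q), and [phi q] vanishes at infinity because [q] is
    bounded. *)
Lemma gauss_mean_by_parts (q q' : R -> R) (K : R) :
  (forall x : R, is_derive x 1 q (q' x)) -> (forall x, `|q x| <= K) -> clg q' ->
  gauss_mean (fun x => x * q x) = gauss_mean q'.
Proof.
move=> dq qK gq'; have cq := continuous_of_derive dq.
have gxq := linear_growth_mul_bounded cq qK.
apply/eqP; rewrite eq_sym -subr_eq0.
have gNxq : clg (fun x => - (x * q x)).
  have := linear_growthZ (-1) gxq; congr clg.
  by apply/funext => x; rewrite mulN1r.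
rewrite -gauss_meanN// -gauss_meanD//.
have [cg [A gA]] : clg (fun x => q' x + - (x * q x)) by exact: linear_growthD.
rewrite (gauss_mean_lebesgue cg gA); apply/eqP.
apply: (@Rintegral_derivative (fun x => phi x * q x)).
- move=> x; have dqx := dq x; have dphi := is_derive_std_normal_pdf x.
  apply: is_derive_eq; rewrite /GRing.scale/=; ring.
- move=> x; apply: cvgM; last exact: cg.
  exact/continuous_normal_pdf/oner_neq0.
- exact: integrable_linear_growth gA.
- apply: (@vanishing_linear_growth _ q K) => x.
  rewrite (le_trans (qK x))// ler_peMr ?lerDl//.
  exact: le_trans (qK 0).
Qed.

(** The solution is F / phi, with F the integral of phi (H - c) from minus infinity. F tends to 0 on
    the left by construction and on the right because c is the mean of [H]. *)
Lemma standard_stein_solution_exists (H : R -> R) : clg H ->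
  exists2 f, (forall x : R, is_derive x 1 f (x * f x + (H x - gauss_mean H)))
           & vanishing (fun x => phi x * f x).
Proof.
move=> gH; set c := gauss_mean H.
have [cg [A gA]] : clg (fun x => H x - c).
  by apply: linear_growthD => //; exact: linear_growth_cst.
pose g x := phi x * (H x - c).
have ig : mu.-integrable setT (EFin \o g) := integrable_linear_growth cg gA.
have contg : continuous g.
  move=> x; apply: cvgM; last exact: cg.
  exact/continuous_normal_pdf/oner_neq0.
have g0 : \int[mu]_x g x = 0.
  rewrite -(gauss_mean_lebesgue cg gA) gauss_meanD//; last exact: linear_growth_cst.
  by rewrite gauss_mean_cst subrr.
pose F x := \int[mu]_(t in `]-oo, x]) g t.
have dF (x : R) : is_derive x 1 F (g x).
  have x1 : x < x + 1 by rewrite ltrDl.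
  have igx : mu.-integrable `]-oo, x + 1] (EFin \o g) by exact: integrableS ig.
  have [dFx Fx] := continuous_FTC1 x1 igx (ltNyr _) (contg x).
  by apply: DeriveDef => //; rewrite -derive1E.
have phi0 x : phi x != 0 by rewrite gt_eqF// std_normal_pdf_gt0.
exists (fun x => F x / phi x) => [x|].
  have dFx := dF x; have dphi := is_derive_std_normal_pdf x.
  apply: is_derive_eq; rewrite /GRing.scale/= /g; field; exact: phi0.
have -> : (fun x => phi x * (F x / phi x)) = F.
  by apply/funext => x; field; exact: phi0.
split.
- rewrite -g0; apply: cvg_Rintegral_set => // x; near=> n.
  rewrite in_setT; apply/mem_set; rewrite /= in_itv/=.
  near: n; exact: nbhs_infty_ger.
- have <- : \int[mu]_(x in set0) g x = 0 by rewrite Rintegral_set0.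
  apply: cvg_Rintegral_set => // x; near=> n.
  rewrite in_set0; apply/negbTE; rewrite notin_setE /= in_itv/=; apply/negP.
  rewrite -ltNge ltrNl; near: n; exact: nbhs_infty_gtr.
Unshelve. all: by end_near. Qed.

End gaussian_integral.

(** * One round of the game *)

Lemma linear_growth_of_bounded_derive (R : realType) (h h' : R -> R) (k : R) :
  (forall x : R, is_derive x 1 h (h' x)) -> (forall x, `|h' x| <= k) ->
  continuous_linear_growth h.
Proof.
move=> dh h'k; split; first exact: continuous_of_derive dh.
by exists (`|h 0| + k) => x; exact: linear_growth_of_derive h'k x.
Qed.

Lemma is_derive_comp_affine (R : realType) (f f' : R -> R) (m s z : R) :
  (forall x : R, is_derive x 1 f (f' x)) ->
  is_derive z 1 (fun z => f (m + s * z)) (s * f' (m + s * z)).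
Proof.
move=> df; have da : is_derive z 1 (fun z => m + s * z) s.
  by apply: is_derive_eq; rewrite /GRing.scale/=; ring.
rewrite mulrC; exact: (@is_derive1_comp _ f (fun z => m + s * z) _ _ _ (df _) da).
Qed.

(** * The Stein equation with general mean and variance *)

Section stein_equation.
Variables (R : realType) (h h' h'' : R -> R).
Hypothesis dh : forall x : R, is_derive x 1 h (h' x).
Hypothesis dh' : forall x : R, is_derive x 1 h' (h'' x).
Hypothesis h'_le1 : forall x, `|h' x| <= 1.
Hypothesis h''_ge0 : forall x, 0 <= h'' x.
Local Notation clg := continuous_linear_growth.
Local Notation phi := (@normal_pdf R 0 1).

Let clg_h : clg h. Proof. exact: linear_growth_of_bounded_derive dh h'_le1. Qed.

Section fixed_parameters.
Variables mu sigma : R.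
Hypothesis sigma_gt0 : 0 < sigma.

Let H z := h (mu + sigma * z).
Let H' z := sigma * h' (mu + sigma * z).
Let H'' z := sigma ^+ 2 * h'' (mu + sigma * z).
Let c := gauss_mean H.

Let dH (z : R) : is_derive z 1 H (H' z).
Proof. exact: is_derive_comp_affine. Qed.

Let dH' (z : R) : is_derive z 1 H' (H'' z).
Proof.
have dc := is_derive_comp_affine mu sigma z dh'.
by apply: is_derive_eq; rewrite /GRing.scale/= /H''; ring.
Qed.

Let H'_le z : `|H' z| <= sigma.
Proof. by rewrite /H' normrM gtr0_norm// ler_piMr// ltW. Qed.

Let H''_ge0 z : 0 <= H'' z.
Proof. by rewrite mulr_ge0// sqr_ge0. Qed.

Let clg_H : clg H. Proof. exact: linear_growth_comp_affine. Qed.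

Lemma stein_solution_exists : exists f, stein_solution mu sigma h f.
Proof.
have [f df vf] := standard_stein_solution_exists clg_H.
have f_le := standard_stein_bound dH H'_le df vf.
have s0 : sigma != 0 by rewrite gt_eqF.
(* The substitution z = (x - mu) / sigma; dividing by sigma turns the bound sigma on the standard
   solution into 1. *)
pose f1 x := sigma^-1 * f (- (sigma^-1 * mu) + sigma^-1 * x).
have df1 (x : R) : is_derive x 1 f1 (((x - mu) * f1 x + (h x - c)) / sigma ^+ 2).
  have dc := is_derive_comp_affine (- (sigma^-1 * mu)) sigma^-1 x df.
  have Hx : H (- (sigma^-1 * mu) + sigma^-1 * x) = h x.
    by rewrite /H; congr h; field.
  by apply: is_derive_eq; rewrite /GRing.scale/= Hx /f1 -/c; field.
exists f1; split; last first.
  move=> x; have df1x := df1 x; split; first exact: ex_derive.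
  rewrite derive_val -/H -/c; field; exact: s0.
exists 1; split; first exact: num_real.
move=> M M1 x _ /=; rewrite (le_trans _ (ltW M1))// /f1 normrM.
by rewrite gtr0_norm ?invr_gt0// mulrC ler_pdivrMr// mul1r.
Qed.

Let f := stein_f mu sigma h.
Let f' x := sigma ^- 2 * ((x - mu) * f x + (h x - c)).

Let stein_f_spec : stein_solution mu sigma h f.
Proof.
have [g] := stein_solution_exists.
exact: (@xgetI _ _ (stein_solution mu sigma h)).
Qed.

Lemma is_derive_stein_f (x : R) : is_derive x 1 f (f' x).
Proof.
have [_ /(_ x)[dfx fx]] := stein_f_spec.
apply: DeriveDef => //; rewrite /f' -/H -/c in fx *.
have s0 : sigma != 0 by rewrite gt_eqF.
rewrite /c /H -fx; field; exact: s0.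
Qed.

(** The inverse rescaling, applied to the solution selected by [stein_f]. It solves the standard
    equation, and boundedness of [f] makes [phi F] vanish, so the standard bounds apply. *)
Let F z := sigma * f (mu + sigma * z).

Let dF (z : R) : is_derive z 1 F (z * F z + (H z - c)).
Proof.
have dc := is_derive_comp_affine mu sigma z is_derive_stein_f.
have s0 : sigma != 0 by rewrite gt_eqF.
by apply: is_derive_eq; rewrite /GRing.scale/= /f' /F /H; field.
Qed.

Let vF : vanishing (fun z => phi z * F z).
Proof.
have [[M0 [_ fM0]] _] := stein_f_spec.
have [M fM] : exists M, forall x, `|f x| <= M.
  by exists (M0 + 1) => x; apply: (fM0 (M0 + 1)) => //; rewrite ltrDl.
apply: (@vanishing_linear_growth _ F (sigma * M)) => z.
have fzM := fM (mu + sigma * z).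
have M_ge0 : 0 <= M by exact: le_trans fzM.
rewrite /F normrM gtr0_norm// -mulrA ler_wpM2l ?(ltW sigma_gt0)//.
by rewrite (le_trans fzM)// ler_peMr// lerDl.
Qed.

Lemma stein_f_bound x : `|f x| <= 1.
Proof.
have := standard_stein_bound dH H'_le dF vF (sigma^-1 * (x - mu)).
have s0 : sigma != 0 by rewrite gt_eqF.
rewrite /F mulrA divff// mul1r (addrC mu) subrK normrM gtr0_norm//.
by rewrite -ler_pdivlMl// mulVf.
Qed.

(** The right-hand side is F' at (x - mu) / sigma. Hence signs carry over, and the Lipschitz
    constant 4 sigma of F' becomes 4 sigma / sigma^3 = 4 / sigma^2 for f'. *)
Let derivativeE x : sigma ^+ 2 * f' x =
  (sigma^-1 * (x - mu)) * F (sigma^-1 * (x - mu)) + (H (sigma^-1 * (x - mu)) - c).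
Proof.
have s0 : sigma != 0 by rewrite gt_eqF.
have e : mu + sigma * (sigma^-1 * (x - mu)) = x by field.
by rewrite /F /H e /f'; field.
Qed.

Lemma stein_f_derive_le0 x : f' x <= 0.
Proof.
rewrite -(pmulr_rle0 _ (exprn_gt0 2 sigma_gt0)) derivativeE.
exact: stein_derivative_le0 dH H'_le dF vF _ dH' H''_ge0 _.
Qed.

Lemma stein_f_derive_lipschitz x y :
  x <= y -> `|f' y - f' x| <= 4 / sigma ^+ 2 * (y - x).
Proof.
move=> xy.
have s0 : sigma != 0 by rewrite gt_eqF.
have xy' : sigma^-1 * (x - mu) <= sigma^-1 * (y - mu).
  by rewrite ler_pM2l ?invr_gt0// lerD2r.
have := stein_derivative_lipschitz dH H'_le dF vF dH' H''_ge0 xy'.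
rewrite -!derivativeE -mulrBr normrM gtr0_norm ?exprn_gt0//.
rewrite -ler_pdivlMl ?exprn_gt0// => /le_trans; apply.
rewrite le_eqVlt; apply/orP; left; apply/eqP; field; exact: s0.
Qed.

Lemma stein_f_eq x :
  h x = c + sigma ^+ 2 * f' x - (x - mu) * f x.
Proof.
have s0 : sigma != 0 by rewrite gt_eqF.
by rewrite /f'; field.
Qed.

Lemma linear_growth_stein_f : clg f.
Proof.
split; first exact: continuous_of_derive is_derive_stein_f.
by exists 1 => x; rewrite mul1r (le_trans (stein_f_bound x))// lerDl.
Qed.

Lemma linear_growth_stein_f_derive : clg f'.
Proof.
have -> : f' = fun x => sigma ^- 2 * ((x * f x + (- mu) * f x) + (h x + (- c))).
  by apply/funext => x; rewrite /f' mulrBl; ring.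
apply/linear_growthZ/linear_growthD.
  apply: linear_growthD; last exact/linear_growthZ/linear_growth_stein_f.
  apply: (linear_growth_mul_bounded _ stein_f_bound).
  exact: continuous_of_derive is_derive_stein_f.
by apply: linear_growthD => //; exact: linear_growth_cst.
Qed.

(** By the mean value theorem the left side is (1 - g^2) f'(x) + g^2 (f'(x) - f'(y)) with |x - y| <=
    1. The first term is nonpositive and the second is controlled by the Lipschitz bound. *)
Lemma stein_f_increment_le (g x : R) : `|g| <= 1 ->
  f' x - g * (f x - f (x - g)) <= 4 / sigma ^+ 2.
Proof.
move=> g1; have fx0 := stein_f_derive_le0 x.
have s2 : 0 < 4 / sigma ^+ 2 by rewrite divr_gt0// exprn_gt0.
have [y xy ->] : exists2 y, `|f' x - f' y| <= 4 / sigma ^+ 2 &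
    f x - f (x - g) = f' y * g.
  (* The sign of [g] determines the order of x - g and x. *)
  have [g0|/ltW g0] := leP 0 g.
    have xg : x - g <= x by rewrite gerBl.
    have [y /andP[gy yx] e] := mean_value is_derive_stein_f xg.
    exists y; last by rewrite e; ring.
    rewrite (le_trans (stein_f_derive_lipschitz yx))// ler_piMr// ?(ltW s2)//.
    by have := ler_norm g; lra.
  have xg : x <= x - g by rewrite lerDl oppr_ge0.
  have [y /andP[xy yg] e] := mean_value is_derive_stein_f xg.
  exists y; last by rewrite -opprB e; ring.
  rewrite distrC (le_trans (stein_f_derive_lipschitz xy))// ler_piMr// ?(ltW s2)//.
  by have := ler0_norm g0; lra.
have g2 : 0 <= g ^+ 2 <= 1 by rewrite sqr_ge0/= -real_normK ?num_real// expr_le1.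
move: xy; rewrite ler_norml => /andP[_].
have -> : f' x - g * (f' y * g) = (1 - g ^+ 2) * f' x + g ^+ 2 * (f' x - f' y) by ring.
by nra.
Qed.

End fixed_parameters.

(** * Change of the smoothed potential in one round; rho = 0 is allowed, as happens in the last
    round *)

Lemma stein_step (s g sigma rho : R) :
  0 < sigma -> sigma ^+ 2 = rho ^+ 2 + 1 -> `|g| <= 1 ->
  gauss_mean (fun z => h (s + g + rho * z)) - gauss_mean (fun z => h (s + sigma * z))
    + g * gauss_mean (fun z => stein_f s sigma h (s + rho * z)) <= 4 / sigma ^+ 2.
Proof.
move=> s0 sr g1; set c := gauss_mean (fun z => h (s + sigma * z)).
pose f := stein_f s sigma h.
pose f' x := sigma ^- 2 * ((x - s) * f x + (h x - c)).
have df : forall x : R, is_derive x 1 f (f' x) by exact: is_derive_stein_f.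
have f_le1 x : `|f x| <= 1 by exact: stein_f_bound.
have gf : clg f by exact: linear_growth_stein_f.
have gf' : clg f' by exact: linear_growth_stein_f_derive.
pose q z := rho * f (s + g + rho * z).
pose q' z := rho ^+ 2 * f' (s + g + rho * z).
have gq' : clg q' by exact/linear_growthZ/linear_growth_comp_affine.
have dq (z : R) : is_derive z 1 q (q' z).
  have dc := is_derive_comp_affine (s + g) rho z df.
  by apply: is_derive_eq; rewrite /GRing.scale/= /q'; ring.
have q_le z : `|q z| <= `|rho| by rewrite /q normrM ler_piMr.
have gzq : clg (fun z => z * q z) := linear_growth_mul_bounded (continuous_of_derive dq) q_le.
have ibp := gauss_mean_by_parts dq q_le gq'.
have gfr : clg (fun z => f (s + rho * z)) by exact: linear_growth_comp_affine.
(* Pointwise upper bound for h(X), X = s + g + rho z. Since X - s = g + rho z and sigma^2 = rho^2 +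
   1, the Stein equation splits into q' - z q, of mean zero by parts, and f'(X) - g f(X), which is
   at most 4 / sigma^2 - g f(X - g). *)
pose rhs z := (c + 4 / sigma ^+ 2 + (- g) * f (s + rho * z)) + (q' z + (-1) * (z * q z)).
have g1' : clg (fun z => c + 4 / sigma ^+ 2 + (- g) * f (s + rho * z)).
  by apply: linear_growthD; [exact: linear_growth_cst|exact: linear_growthZ].
have g2' : clg (fun z => q' z + (-1) * (z * q z)).
  by apply: linear_growthD => //; exact: linear_growthZ.
have : gauss_mean (fun z => h (s + g + rho * z)) <= gauss_mean rhs.
  apply: gauss_mean_le; [exact: linear_growth_comp_affine|exact: linear_growthD|move=> z].
  pose X := s + g + rho * z.
  have : f' X - g * (f X - f (X - g)) <= 4 / sigma ^+ 2.
    exact: stein_f_increment_le.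
  have : h X = c + sigma ^+ 2 * f' X - (X - s) * f X by exact: stein_f_eq.
  have -> : X - g = s + rho * z by rewrite /X; ring.
  by rewrite /rhs /q /q' -/X sr /X; lra.
have -> : gauss_mean rhs = c + 4 / sigma ^+ 2
    + (- g) * gauss_mean (fun z => f (s + rho * z)).
  rewrite /rhs (gauss_meanD g1' g2').
  rewrite (gauss_meanD (linear_growth_cst _) (linear_growthZ _ gfr)).
  rewrite (gauss_meanD gq' (linear_growthZ _ gzq)).
  by rewrite gauss_mean_cst (gauss_meanZ _ gfr) (gauss_meanZ _ gzq) ibp; ring.
rewrite -/f; lra.
Qed.

End stein_equation.

(** * Duality and derivatives for ln cosh *)

Section cosh.
Variable R : realType.

Lemma cosh_gt0 (x : R) : 0 < cosh x.
Proof. by rewrite divr_gt0// addr_gt0// expR_gt0. Qed.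

(* Gibbs' inequality for the laws (1 + u, 1 - u) / 2 and (e^-y, e^y) / (2 cosh y). *)
Lemma ln_cosh_fenchel (u y : R) : -1 <= u <= 1 ->
  - (u * y) - ln (cosh y) <=
    2^-1 * ln ((1 + u) `^ (1 + u) * (1 - u) `^ (1 - u)).
Proof.
move=> /andP[u1 u2].
(* One term of the inequality, from ln t <= t - 1 at t = e^z / (a cosh y). It is used with a = 1 +
   u, z = -y and a = 1 - u, z = y, where the corrections e^z / cosh y - a add up to 0. *)
have key (a z : R) : 0 <= a ->
    a * (z - ln (cosh y)) <= a * ln a + (expR z / cosh y - a).
  rewrite le_eqVlt => /predU1P[<-|a0].
    by rewrite !mul0r add0r subr0 divr_ge0// ?expR_ge0// ltW ?cosh_gt0.
  have q0 : 0 < expR z / cosh y / a by rewrite divr_gt0// divr_gt0 ?expR_gt0 ?cosh_gt0.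
  have := @le_ln1Dx _ (expR z / cosh y / a - 1).
  rewrite (addrC 1) subrK ltrBrDl subrr  => /(_ q0).
  have e0 : 0 < expR z / cosh y by rewrite divr_gt0 ?expR_gt0 ?cosh_gt0.
  rewrite ln_div ?posrE// ln_div ?posrE ?expR_gt0 ?cosh_gt0// expRK => h.
  have := ler_wpM2l (ltW a0) h.
  have -> : a * (expR z / cosh y / a - 1) = expR z / cosh y - a.
    by field; rewrite !gt_eqF ?cosh_gt0.
  lra.
have a0 : 0 <= 1 + u by lra.
have b0 : 0 <= 1 - u by lra.
(* At a = 0 this is the convention 0^0 = 1, which covers u = 1 and u = -1. *)
have powR_self_gt0 (a : R) : 0 <= a -> 0 < a `^ a.
  rewrite le_eqVlt => /predU1P[<-|a1]; first by rewrite powRr0.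
  exact: powR_gt0.
rewrite lnM ?posrE ?powR_self_gt0// !ln_powR.
have := key _ (- y) a0; have := key _ y b0.
have : expR (- y) / cosh y + expR y / cosh y = 2.
  rewrite -mulrDl /cosh; field.
  by rewrite gt_eqF// addr_gt0// expR_gt0.
lra.
Qed.

Definition tanh (x : R) := (expR x - expR (- x)) / (expR x + expR (- x)).

Lemma tanh_bound (x : R) : `|tanh x| <= 1.
Proof.
have := expR_gt0 x; have := expR_gt0 (- x) => h1 h2.
rewrite normrM normfV (gtr0_norm (addr_gt0 h2 h1)) ler_pdivrMr ?addr_gt0//.
by rewrite mul1r ler_norml; lra.
Qed.

Lemma is_derive_tanh (x : R) : is_derive x 1 tanh (1 - tanh x ^+ 2).
Proof.
have n0 : expR x + expR (- x) != 0 by rewrite gt_eqF// addr_gt0// expR_gt0.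
by apply: is_derive_eq; rewrite /GRing.scale/= /tanh; field.
Qed.

Lemma is_derive_ln_cosh (x : R) : is_derive x 1 (fun x => ln (cosh x)) (tanh x).
Proof.
have n0 : expR x + expR (- x) != 0 by rewrite gt_eqF// addr_gt0// expR_gt0.
have dc : is_derive x 1 (@cosh R) ((expR x - expR (- x)) / 2).
  by apply: is_derive_eq; rewrite /GRing.scale/=; field.
have dl := is_derive1_ln (cosh_gt0 x).
apply: is_derive_eq (@is_derive1_comp _ (@ln R) (@cosh R) _ _ _ dl dc) _.
by rewrite /tanh /cosh; field.
Qed.

Lemma is_derive_tanhM (a x : R) :
  is_derive x 1 (fun x => tanh (a * x)) (a * (1 - tanh (a * x) ^+ 2)).
Proof.
have e z : 0 + a * z = a * z by rewrite add0r.
have := is_derive_comp_affine 0 a x is_derive_tanh.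
by under eq_fun do rewrite e; rewrite e.
Qed.

Lemma is_derive_ln_coshM (a x : R) : a != 0 ->
  is_derive x 1 (fun x => a^-1 * ln (cosh (a * x))) (tanh (a * x)).
Proof.
move=> a0; have e z : 0 + a * z = a * z by rewrite add0r.
have := is_derive_comp_affine 0 a x is_derive_ln_cosh.
under eq_fun do rewrite e.
rewrite e => dl; apply: is_derive_eq.
by rewrite /GRing.scale/=; field.
Qed.

End cosh.

(** * Reading moves off the transcript of the game *)

Section olo_history.
Variables (R : realType) (alg : olo_algorithm R) (adv : olo_adversary R).

Lemma olo_historyS t : exists x g,
  olo_history alg adv t.+1 =
    (rcons (olo_history alg adv t).1 x, rcons (olo_history alg adv t).2 g) /\
  x = alg (olo_history alg adv t).2.
Proof. by rewrite /=; case: olo_history => xs gs; do 2 eexists. Qed.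

Lemma olo_xS t : olo_x alg adv t.+1 = alg (olo_history alg adv t).2.
Proof. by rewrite /olo_x; have [x [g [-> ->]]] := olo_historyS t; rewrite last_rcons. Qed.

Lemma olo_history_gS t : (olo_history alg adv t.+1).2 =
  rcons (olo_history alg adv t).2 (olo_g alg adv t.+1).
Proof. by rewrite /olo_g; have [x [g [-> _]]] := olo_historyS t; rewrite last_rcons. Qed.

Lemma size_olo_history t : size (olo_history alg adv t).2 = t.
Proof. by elim: t => //= t IH; rewrite olo_history_gS size_rcons IH. Qed.

End olo_history.

(** Here [harmonic k] is 1 / (k + 1). The induction step is 1 / m <= ln m - ln (m - 1), that is ln
    (1 + x) <= x at x = -1 / m. *)
Lemma harmonic_sum_le (R : realType) (n : nat) : (0 < n)%N ->
  \sum_(0 <= k < n) harmonic k <= 1 + ln n%:R :> R.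
Proof.
elim: n => // -[_ _|n IH _].
  by rewrite big_nat1 /harmonic/= invr1 ln1 addr0.
rewrite big_nat_recr//= (le_trans (lerD (IH isT) (lexx _)))//.
rewrite -addrA lerD2l -lerBrDl.
have n0 : 0 < n.+1%:R :> R by rewrite ltr0n.
have m0 : 0 < n.+2%:R :> R by rewrite ltr0n.
have := @le_ln1Dx R (- n.+2%:R^-1).
rewrite (_ : 1 + - n.+2%:R^-1 = n.+1%:R / n.+2%:R :> R); last first.
  rewrite -[n.+2%:R]natr1; move: n0; set a := n.+1%:R => a0; field.
  by rewrite gt_eqF//; lra.
rewrite ln_div ?posrE// ltrN2 invf_lt1// ltr1n => /(_ isT) h.
by rewrite /harmonic/= -opprB lerNr.
Qed.

(** * Summation over the rounds and the regret bound *)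

Theorem corollary3 (R : realType) :
  exists C : R, forall (T : nat) (alpha : R), (1 <= T)%N -> 0 < alpha ->
    let eta : R := alpha / Num.sqrt T%:R in
    let h : R -> R := fun x => eta^-1 * ln (cosh (eta * x)) in
    let rho : nat -> R := fun t => Num.sqrt (T%:R - t%:R) in
    let alg : olo_algorithm R := stein_algorithm h rho in
    forall adv : olo_adversary R,
      (forall t : nat, (1 <= t <= T)%N -> `|olo_g alg adv t| <= 1) ->
      forall u : R, -1 <= u <= 1 ->
        \sum_(1 <= t < T.+1) olo_g alg adv t * (olo_x alg adv t - u)
        <= ((2 * alpha)^-1 * ln ((1 + u) `^ (1 + u) * (1 - u) `^ (1 - u))
            + gauss_mean (fun z => alpha^-1 * ln (cosh (alpha * z))))
             * Num.sqrt T%:R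
           + C * (1 + ln T%:R).
Proof.
(* The 4 of the error 4 / sigma^2 in [stein_step]. *)
exists 4 => T alpha T1 alpha0 eta h rho alg adv g_le1 u u1.
set g := olo_g alg adv in g_le1 *; set x := olo_x alg adv.
have sT0 : 0 < Num.sqrt T%:R :> R by rewrite sqrtr_gt0 ltr0n.
have eta0 : 0 < eta by rewrite divr_gt0.
pose h' y := tanh (eta * y); pose h'' y := eta * (1 - tanh (eta * y) ^+ 2).
have dh (y : R) : is_derive y 1 h (h' y).
  by apply: is_derive_ln_coshM; rewrite gt_eqF.
have dh' (y : R) : is_derive y 1 h' (h'' y) by exact: is_derive_tanhM.
have h'_le1 y : `|h' y| <= 1 by exact: tanh_bound.
have h''_ge0 y : 0 <= h'' y.
  rewrite mulr_ge0 ?(ltW eta0)// subr_ge0 -real_normK ?num_real//.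
  by rewrite expr_le1// tanh_bound.
pose S t := \sum_(1 <= i < t.+1) g i.
pose V t := gauss_mean (fun z => h (S t + rho t * z)).
have S0 : S 0%N = 0 by rewrite /S big_geq.
have SS t : S t.+1 = S t + g t.+1 by rewrite /S big_nat_recr.
have sumg t : \sum_(r <- (olo_history alg adv t).2) r = S t.
  elim: t => [|t IH]; first by rewrite S0 big_nil.
  by rewrite olo_history_gS -cats1 big_cat big_seq1/= IH SS.
have rhoE t : (t <= T)%N -> rho t ^+ 2 = (T - t)%:R.
  by move=> tT; rewrite sqr_sqrtr ?subr_ge0 ?ler_nat// natrB.
(* This is round t + 1, with variance rho_t^2 = T - t; the shift in [harmonic] makes the error 4 /
   (T - t). *)
have step t : (t < T)%N ->
    V t.+1 - V t + g t.+1 * x t.+1 <= 4 * harmonic (T - t.+1)%N.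
  move=> tT.
  have rt0 : 0 < rho t by rewrite sqrtr_gt0 subr_gt0 ltr_nat.
  have r2 : rho t ^+ 2 = rho t.+1 ^+ 2 + 1.
    by rewrite (rhoE _ (ltnW tT)) (rhoE _ tT) natr1 subnSK.
  have gt1 : `|g t.+1| <= 1 by exact: (g_le1 t.+1 tT).
  have := stein_step dh dh' h'_le1 h''_ge0 (S t) rt0 r2 gt1.
  rewrite (rhoE _ (ltnW tT)) -(subnSK tT) -SS.
  by rewrite /x olo_xS /alg /stein_algorithm size_olo_history sumg.
have regret : V T - V 0%N + \sum_(1 <= t < T.+1) g t * x t <= 4 * (1 + ln T%:R).
  apply: (@le_trans _ _ (\sum_(0 <= t < T) 4 * harmonic (T - t.+1)%N)); last first.
    rewrite -mulr_sumr ler_wpM2l// big_nat_rev/= add0n.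
    apply: le_trans (harmonic_sum_le R T1).
    rewrite le_eqVlt; apply/orP; left; apply/eqP.
    apply: eq_big_nat => i /andP[_ iT].
    have e : (T - (T - i.+1).+1)%N = i by rewrite (subnSK iT) subKn// ltnW.
    by rewrite e.
  rewrite -(telescope_sumr V (leq0n T)) big_add1 -big_split/=.
  by rewrite ler_sum_nat// => t /andP[_ tT]; exact: step.
(* As rho_T = 0, no smoothing is left at the end. *)
have VT : V T = h (S T).
  rewrite /V /rho subrr sqrtr0; under eq_fun do rewrite mul0r addr0.
  exact: gauss_mean_cst.
have etaV : eta^-1 = alpha^-1 * Num.sqrt T%:R by rewrite invf_div mulrC.
(* Here rho_0 is the square root of T, so that eta rho_0 = alpha. *)
have V0 : V 0%N = gauss_mean (fun z => alpha^-1 * ln (cosh (alpha * z))) * Num.sqrt T%:R.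
  rewrite /V S0 /rho subr0 /h mulrC -gauss_meanZ; last first.
    apply: (@linear_growth_of_bounded_derive _ _ (fun z => tanh (alpha * z)) 1) => z.
      by apply: is_derive_ln_coshM; rewrite gt_eqF.
    exact: tanh_bound.
  congr gauss_mean; apply/funext => z.
  rewrite add0r etaV /eta mulrA divfK ?gt_eqF//; ring.
(* Multiplied by 1 / eta, this bounds -u S_T - h(S_T), the part depending on the final sum. *)
have fenchel := ln_cosh_fenchel (eta * S T) u1.
have -> : \sum_(1 <= t < T.+1) g t * (x t - u) =
    \sum_(1 <= t < T.+1) g t * x t - u * S T.
  rewrite /S mulr_sumr -sumrB; apply: eq_bigr => t _; ring.
have : - (u * S T) - h (S T) <=
    (2 * alpha)^-1 * ln ((1 + u) `^ (1 + u) * (1 - u) `^ (1 - u)) * Num.sqrt T%:R.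
  have ieta0 : 0 <= eta^-1 by rewrite invr_ge0 ltW.
  have := ler_wpM2l ieta0 fenchel.
  rewrite mulrBr {1}etaV -/(h (S T)).
  have -> : alpha^-1 * Num.sqrt T%:R * - (u * (eta * S T)) = - (u * S T).
    by rewrite /eta; field; rewrite !gt_eqF.
  move=> /le_trans; apply; rewrite etaV le_eqVlt; apply/orP; left; apply/eqP.
  by field; rewrite gt_eqF.
rewrite [(_ + gauss_mean _) * _]mulrDl -V0; rewrite VT in regret; lra.
Qed.
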